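(* Let $X$ be the class of all graphs $H$ such that $H$ is (isomorphic to) an induced subgraph of the Kneser graph $KG_{3n,n}$ for some positive integer $n$. Then $X$ has linear Ramsey numbers and unbounded co-chromatic number.
   Context: The Kneser graph $KG_{a,b}$ has as vertices the $b$-element subsets of a set of size $a$, two vertices being adjacent if and only if the corresponding subsets are disjoint. For a class $X$ of graphs and positive integers $p,q$, $R_X(p,q)$ is the minimum $m$ such that every graph in $X$ with at least $m$ vertices has either a clique of size $p$ or an independent set of size $q$. Ramsey numbers are linear in $X$ if there is a constant $k$ such that $R_X(p,q)\le k(p+q)$ for all positive integers $p,q$. The co-chromatic number of a graph $G$ is the minimum $k$ such that the vertex set of $G$ can be partitioned into $k$ subsets each of which is either a clique or an independent set. A class has unbounded co-chromatic number if there is no constant bounding the co-chromatic number of all graphs in the class. *)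

(* Defs.v *)
From mathcomp Require Import all_boot.

Set Implicit Arguments.
Unset Strict Implicit.
Unset Printing Implicit Defensive.

Record sgraph := SGraph {
  vertex :> finType;
  edge : rel vertex;
  edge_sym : symmetric edge;
  edge_irrefl : irreflexive edge
}.

Definition graph_class := sgraph -> Prop.

Definition isomorphic (G H : sgraph) : Prop :=
  exists2 f : G -> H, bijective f & forall x y, edge (f x) (f y) = edge x y.

Section Induced.
Variables (G : sgraph) (S : {set G}).

Definition induced_edge : rel {x : G | x \in S} :=
  fun x y => edge (val x) (val y).

Fact induced_edge_sym : symmetric induced_edge.
Proof. by move=> x y; apply: edge_sym. Qed.

Fact induced_edge_irrefl : irreflexive induced_edge.
Proof. by move=> x; apply: edge_irrefl. Qed.

Definition induced_subgraph : sgraph :=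
  SGraph induced_edge_sym induced_edge_irrefl.

End Induced.

Section Kneser.
Variables a b : nat.

(* The condition [x != y] only matters for b = 0, where the unique vertex, the
   empty set, is disjoint from itself. *)
Definition kneser_edge : rel {A : {set 'I_a} | #|A| == b} :=
  fun x y => (x != y) && [disjoint val x & val y].

Fact kneser_edge_sym : symmetric kneser_edge.
Proof. by move=> x y; rewrite /kneser_edge eq_sym disjoint_sym. Qed.

Fact kneser_edge_irrefl : irreflexive kneser_edge.
Proof. by move=> x; rewrite /kneser_edge eqxx. Qed.

Definition kneser : sgraph := SGraph kneser_edge_sym kneser_edge_irrefl.

End Kneser.

Section HomogeneousSets.
Variable G : sgraph.
Implicit Types (S : {set G}) (P : {set {set G}}).

Definition clique S : bool :=
  [forall x in S, forall y in S, (x != y) ==> edge x y].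

Definition independent S : bool :=
  [forall x in S, forall y in S, ~~ edge x y].

Definition cocoloring P : bool :=
  partition P [set: G] && [forall S in P, clique S || independent S].

Fact ex_cocoloring : exists k, [exists P, cocoloring P && (#|P| == k)].
Proof.
pose P := preim_partition id [set: G].
exists #|P|; apply/existsP; exists P; rewrite eqxx andbT /cocoloring.
rewrite preim_partitionP /=; apply/forall_inP => _ /imsetP[x _ ->].
apply/orP; right; apply/forall_inP => y; rewrite !inE => /eqP <-.
by apply/forall_inP => z; rewrite !inE => /eqP <-; rewrite edge_irrefl.
Qed.

Definition cochromatic_number : nat := ex_minn ex_cocoloring.

End HomogeneousSets.

Definition ramsey_bound (X : graph_class) (p q m : nat) : Prop :=
  forall G : sgraph, X G -> m <= #|G| ->
    (exists2 S : {set G}, clique S & #|S| = p) \/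
    (exists2 S : {set G}, independent S & #|S| = q).

(* R_X(p,q) = m. This is a relation because choosing the minimum by a function
   would require Ramsey's theorem in order to know that a bound exists. *)
Definition is_ramsey_number (X : graph_class) (p q m : nat) : Prop :=
  ramsey_bound X p q m /\ forall m', ramsey_bound X p q m' -> m <= m'.

Definition linear_ramsey_numbers (X : graph_class) : Prop :=
  exists k : nat, forall p q : nat, 0 < p -> 0 < q ->
    exists2 m, is_ramsey_number X p q m & m <= k * (p + q).

Definition unbounded_cochromatic_number (X : graph_class) : Prop :=
  ~ exists k : nat, forall G : sgraph, X G -> cochromatic_number G <= k.

Definition kneser3_class : graph_class := fun H =>
  exists2 n : nat, 0 < n &
    exists S : {set kneser (3 * n) n}, isomorphic H (induced_subgraph S).

(* Main.v *)
Require Import Defs.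
From mathcomp Require Import all_boot.
From mathcomp Require Import fingroup perm zify.
From Stdlib Require Import Classical.

Set Implicit Arguments.
Unset Strict Implicit.
Unset Printing Implicit Defensive.

(** A family of N subsets of size n of [3n] has a point lying in at least N/3 of
    them, and the sets through a point form an independent set; this gives
    R(p, q) <= 3q.  Cliques have at most 3 vertices, so a bounded co-chromatic
    number would bound the chromatic number of KG_{3n,n}.  That number is
    unbounded because KG_{3n,n} with 3n = N! receives a homomorphism from the
    shift graph on triples i < j < k of [N], in which (i,j,k) and (j,k,l) are
    adjacent: send (i,j,k) to the set of those N!/3 permutations s of [N] for
    which s j is the largest of s i, s j, s k.  The triple shift graph has no
    proper colouring with c colours as soon as N > 2^(2^c): colour a pair (j,k)
    with the set of colours of the triples (i,j,k), then colour k with the set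
    of colours of the pairs (j,k); distinct vertices get distinct colours. *)

Lemma ksubset_exists (T : finType) (B : {set T}) k :
  k <= #|B| -> exists2 A : {set T}, A \subset B & #|A| == k.
Proof.
rewrite -bin_gt0 -cards_draws card_gt0 => /set0Pn[A].
by rewrite inE => /andP[]; exists A.
Qed.

Lemma sum_card_star (I V : finType) (S : {set V}) (F : V -> {set I}) :
  \sum_(x in S) #|F x| = \sum_i #|[set x in S | i \in F x]|.
Proof.
under eq_bigr => x _ do rewrite -sum1_card.
rewrite (exchange_big_dep xpredT) //=.
by apply: eq_bigr => i _; rewrite -sum1_card; apply: eq_bigl => x; rewrite inE.
Qed.

(** Double counting of incidences: the sets of a clique are pairwise disjoint, so each of the 3n
    points lies in at most one of them. *)
Lemma kneser_clique_card n (S : {set kneser (3 * n) n}) :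
  0 < n -> clique S -> #|S| <= 3.
Proof.
move=> n_gt0 cliqueS; rewrite -(leq_pmul2r n_gt0).
have -> : #|S| * n = \sum_(x in S) #|val x|.
  by rewrite -sum_nat_const; apply: eq_bigr => x _; rewrite (eqP (valP x)).
apply: (@leq_trans (\sum_(i < 3 * n) 1)); last first.
  by rewrite big_const_ord iter_addn_0 mul1n.
rewrite sum_card_star; apply: leq_sum => i _; apply/card_le1_eqP => x y.
rewrite !inE => /andP[xS ix] /andP[yS iy].
have [//|neq_xy] := eqVneq x y.
have := forall_inP (forall_inP cliqueS _ xS) _ yS; rewrite neq_xy.
by case/andP => _ disj; rewrite (disjointFr disj ix) in iy.
Qed.

Lemma kneser3_class_ramsey_bound p q :
  0 < q -> ramsey_bound kneser3_class p q (3 * q).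
Proof.
move=> q_gt0 G [n n_gt0 [S [f _ fE]]] leG; right.
pose F (x : G) : {set 'I_(3 * n)} := val (val (f x)).
have [i lei] : exists i, q <= #|[set x in [set: G] | i \in F x]|.
  apply/existsP; rewrite -[X in is_true X]negbK negb_exists; apply/negP.
  move=> /forallP small.
  (* If every point lay in at most q - 1 sets, counting incidences would give n * #|G| <= 3n(q - 1),
     against 3q <= #|G|. *)
  have : \sum_(x in [set: G]) #|F x| <= 3 * n * q.-1.
    have -> : 3 * n * q.-1 = \sum_(i < 3 * n) q.-1.
      by rewrite big_const_ord iter_addn_0 mulnC.
    rewrite sum_card_star.
    by apply: leq_sum => i _; have := small i; rewrite -ltnNge; case: (q) q_gt0.
  rewrite (eq_bigr (fun=> n)) => [|x _]; last exact: eqP (valP (val (f x))).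
  by rewrite sum_nat_const cardsT; nia.
have [A /subsetP subA /eqP cardA] := ksubset_exists lei.
exists A => //; apply/forall_inP => x /subA; rewrite !inE => ix.
apply/forall_inP => y /subA; rewrite !inE => iy; rewrite -fE; apply/negP.
by case/andP => _ disj; rewrite (disjointFr disj ix) in iy.
Qed.

(** [ramsey_bound] is a [Prop] ranging over all graphs, so its minimum is reached by descent from b
    with excluded middle. *)
Lemma ex_ramsey_number X p q b :
  ramsey_bound X p q b -> exists2 m, is_ramsey_number X p q m & m <= b.
Proof.
elim/ltn_ind: b => b IHb Xb.
have [[m [Xm ltmb]]|minb] := classic (exists m, ramsey_bound X p q m /\ m < b).
  by have [r Xr lerm] := IHb _ ltmb Xm; exists r => //; lia.
exists b => //; split=> // m Xm; rewrite leqNgt; apply/negP => ltmb.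
by apply: minb; exists m.
Qed.

Lemma kneser_in_kneser3_class n : 0 < n -> kneser3_class (kneser (3 * n) n).
Proof.
move=> n_gt0; exists n => //; exists setT.
exists (fun x => exist _ x (in_setT x)) => //.
by exists val => // x; apply: val_inj.
Qed.

(* Splitting each clique of an optimal cocolouring into singletons. *)
Lemma cochromatic_proper_coloring (G : sgraph) w k :
  (forall S : {set G}, clique S -> #|S| <= w.+1) -> cochromatic_number G <= k ->
  exists c : G -> 'I_k.+1 * 'I_w.+1, forall x y, edge x y -> c x != c y.
Proof.
move=> clique_le; rewrite /cochromatic_number; case: ex_minnP => m.
case/existsP => P /andP[/andP[partP homP] /eqP cardP] _ le_mk.
have PB x : pblock P x \in P by rewrite pblock_mem // (cover_partition partP).
have xB x : x \in pblock P x by rewrite mem_pblock (cover_partition partP).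
(* The colour records the part and the position in it. [inord] sends positions above w to 0; these
   occur only in independent parts, which contain no edge. *)
exists (fun x => (inord (index (pblock P x) (enum P)),
                  inord (index x (enum (pblock P x))))).
move=> x y xy; apply/negP => /eqP[].
move=> /(congr1 val) /= + /(congr1 val) /=.
have ltP z : index (pblock P z) (enum P) < k.+1.
  apply: (@leq_trans #|P|); last by rewrite cardP leqW.
  by rewrite cardE index_mem mem_enum.
rewrite (inordK (ltP x)) (inordK (ltP y)) => idxB.
have Bxy : pblock P x = pblock P y.
  by apply: (index_inj (pblock P y) _ _ idxB); rewrite mem_enum.
have /orP[cliqueB|indepB] := forall_inP homP _ (PB y); last first.
  move/forall_inP/(_ x)/(_ _)/forall_inP/(_ y): indepB.
  by rewrite xy -{1}Bxy !xB => /(_ isT isT).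
have ltB z : z \in pblock P y -> index z (enum (pblock P y)) < w.+1.
  move=> zB; apply: leq_trans (clique_le _ cliqueB).
  by rewrite cardE index_mem mem_enum.
have xBy : x \in pblock P y by rewrite -Bxy.
rewrite Bxy !inordK ?ltB // => idx_xy.
have eq_xy : x = y.
  by apply: (index_inj y _ _ idx_xy); rewrite mem_enum.
by rewrite eq_xy edge_irrefl in xy.
Qed.

Lemma triple_shift_coloring N (T : finType) (c : 'I_N -> 'I_N -> 'I_N -> T) :
  (forall i j k l : 'I_N, i < j -> j < k -> k < l -> c i j k != c j k l) ->
  N <= 2 ^ 2 ^ #|T|.
Proof.
move=> proper_c.
pose D (j k : 'I_N) := [set c i j k | i in [pred i : 'I_N | i < j]].
pose E (k : 'I_N) := [set D j k | j in [pred j : 'I_N | j < k]].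
(* If E k = E l, then D k l lies in E k, so D k l = D j k for some j < k. Hence c j k l, a member of
   D k l, equals c i j k for some i < j, against properness. *)
have E_lt (k l : 'I_N) : k < l -> E k <> E l.
  move=> ltkl eqE.
  have : D k l \in E l by apply/imsetP; exists k.
  rewrite -eqE => /imsetP[j ltjk eqD].
  have : c j k l \in D k l by apply/imsetP; exists j.
  rewrite eqD => /imsetP[i ltij eqc].
  by have := proper_c _ _ _ _ ltij ltjk ltkl; rewrite eqc eqxx.
have injE : injective E.
  move=> k l eqE; apply: val_inj.
  by case: (ltngtP k l) => // [/E_lt|/E_lt/nesym].
have card_set (V : finType) : #|{set V}| = 2 ^ #|V|.
  by rewrite -[LHS]cardsT -powersetT card_powerset cardsT.
by rewrite -!card_set -[leqLHS]card_ord (leq_card _ injE).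
Qed.

Section Peaks.
Variable N : nat.
Implicit Types (i j k l : 'I_N) (s : {perm 'I_N}).

Definition peak i j k := [set s : {perm 'I_N} | (s i < s j) && (s k < s j)].

Lemma peakC i j k : peak i j k = peak k j i.
Proof. by apply/setP => s; rewrite !inE andbC. Qed.

(** Precomposing with the transposition of i and j exchanges s i and s j and keeps s k. *)
Lemma card_peak_swap i j k :
  i != j -> j != k -> i != k -> #|peak i j k| = #|peak j i k|.
Proof.
move=> ij jk ik; rewrite -(card_imset (peak j i k) (mulgI (tperm i j))).
apply: eq_card => s; rewrite -[s in LHS](mulKg (tperm i j)) tpermV.
set t := (tperm i j * s)%g.
have -> : s = (tperm i j * t)%g by rewrite mulgA tperm2 mul1g.
rewrite mem_imset ?inE; last exact: mulgI.
by rewrite mulgA tperm2 mul1g !permM tpermL tpermR tpermD.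
Qed.

(** Exactly one of s i, s j, s k is the largest, so three peak sets, equal in size by symmetry,
    partition the permutations. *)
Lemma card_peak i j k :
  i != j -> j != k -> i != k -> 3 * #|peak i j k| = N`!.
Proof.
move=> ij jk ik.
rewrite -card_Sn.
have -> : #|{perm 'I_N}| = #|peak i j k :|: peak j i k :|: peak i k j|.
  apply: eq_card => s; rewrite !inE; apply/esym.
  have : s i != s j by rewrite (inj_eq perm_inj).
  have : s j != s k by rewrite (inj_eq perm_inj).
  have : s i != s k by rewrite (inj_eq perm_inj).
  by rewrite -!val_eqE /=; lia.
rewrite !cardsU.
have -> : peak i j k :&: peak j i k = set0.
  by apply/setP => s; rewrite !inE; lia.
have -> : (peak i j k :|: peak j i k) :&: peak i k j = set0.
  by apply/setP => s; rewrite !inE; lia.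
have <- : #|peak i j k| = #|peak j i k| by exact: card_peak_swap.
have <- : #|peak i j k| = #|peak i k j|.
  by rewrite peakC (peakC i k) card_peak_swap // eq_sym.
by rewrite cards0; lia.
Qed.

Lemma disjoint_peak i j k l : [disjoint peak i j k & peak j k l].
Proof.
by rewrite -setI_eq0; apply/eqP/setP => s; rewrite !inE; lia.
Qed.

End Peaks.

Lemma kneser_coloring_bound N n (T : finType) (c : kneser (3 * n) n -> T) :
  0 < n -> 3 * n = N`! -> (forall x y, edge x y -> c x != c y) ->
  N <= 2 ^ 2 ^ #|T|.
Proof.
move=> n_gt0 eqn proper_c.
have eqP3n : #|{perm 'I_N}| = 3 * n by rewrite card_Sn.
pose h s := cast_ord eqP3n (enum_rank s).
have h_inj : injective h by move=> s t /cast_ord_inj/enum_rank_inj.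
have card_h (i j k : 'I_N) : i < j -> j < k -> #|h @: peak i j k| == n.
  move=> ltij ltjk; rewrite card_imset // -(eqn_pmul2l (isT : 0 < 3)) eqn.
  by rewrite card_peak // -val_eqE /=; lia.
have [x0] : exists x0 : kneser (3 * n) n, true.
  have [|A _ cardA] := @ksubset_exists _ [set: 'I_(3 * n)] n.
    by rewrite cardsT card_ord; lia.
  by exists (exist _ A cardA).
(* The default [x0] is never taken when i < j < k, by [card_h]. *)
pose F i j k : kneser (3 * n) n := insubd x0 (h @: peak i j k).
have FE (i j k : 'I_N) : i < j -> j < k -> val (F i j k) = h @: peak i j k.
  by move=> ltij ltjk; rewrite val_insubd card_h.
move=> _; apply: (@triple_shift_coloring _ _ (fun i j k => c (F i j k))).
move=> i j k l ltij ltjk ltkl; apply: proper_c.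
have disF : [disjoint val (F i j k) & val (F j k l)].
  by rewrite !FE // imset_disjoint // ?disjoint_peak //; apply: in2W.
(* Adjacency also asks for distinct vertices: a set disjoint from itself is empty, but n > 0. *)
rewrite /= /kneser_edge disF andbT; apply/eqP => eqF.
move: disF; rewrite eqF -setI_eq0 setIid => /eqP F0.
by have := valP (F j k l); rewrite F0 cards0 eq_sym eqn0Ngt n_gt0.
Qed.

Theorem theorem1 :
  linear_ramsey_numbers kneser3_class /\
  unbounded_cochromatic_number kneser3_class.
Proof.
split.
  exists 3 => p q _ q_gt0.
  have [m Xm lem] := ex_ramsey_number (kneser3_class_ramsey_bound p q_gt0).
  by exists m => //; lia.
case=> k bounded.
(* There are (k + 1) * 3 colours, cliques having at most 3 vertices. The summand 3 makes 3 divide N!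
   and N exceed the colouring bound. *)
pose N := (2 ^ 2 ^ (k.+1 * 3) + 3).
have /dvdnP[n eqN] : 3 %| N`! by rewrite dvdn_fact // leq_addl.
rewrite mulnC in eqN.
have n_gt0 : 0 < n by have := fact_gt0 N; rewrite eqN muln_gt0.
have cliques (S : {set kneser (3 * n) n}) := @kneser_clique_card n S n_gt0.
have [c proper_c] :=
  cochromatic_proper_coloring cliques (bounded _ (kneser_in_kneser3_class n_gt0)).
have := kneser_coloring_bound n_gt0 (esym eqN) proper_c.
by rewrite card_prod !card_ord /N; lia.
Qed.
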